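(* Let $d\ge1$ and let $(V_\gamma)_{\gamma>0}$ be a family of i.i.d. non-negative potentials $V_\gamma=(V_\gamma(x))_{x\in\mathbb{Z}^d}$ with $\mathbb{P}[V_\gamma(0)>0]>0$ for all $\gamma>0$. Assume that $\mathbb{E}[V_\gamma(0)]<\infty$ for all $\gamma>0$. Then for all $\ell\in\mathbb{R}^d$, $$\limsup_{\gamma\searrow0}\frac{\alpha_{V_\gamma}(\ell)}{\sqrt{\gamma}}\le\limsup_{\gamma\searrow0}\sqrt{\frac{2d\,\mathbb{E}[V_\gamma(0)]}{\gamma}}\ \|\ell\|_2 .$$
   Context: For each fixed $\gamma>0$ the random variables $V_\gamma(x)$, $x\in\mathbb{Z}^d$, are i.i.d. under a probability measure $\mathbb{P}$ with expectation $\mathbb{E}$. Let $(S(n))_{n\ge0}$ be the symmetric nearest-neighbor random walk on $\mathbb{Z}^d$ started at $0$, defined on a different probability space with measure $P$ and expectation $E$, and let $H(y)=\inf\{n\ge0\mid S(n)=y\}$. For a potential $U=(U(x))_{x\in\mathbb{Z}^d}$ of i.i.d. non-negative random variables with $\mathbb{P}[U(0)>0]>0$ put $$e(0,y,U)=E\Big[\exp\Big(-\sum_{n=0}^{H(y)-1}U(S(n))\Big)\mathbf{1}_{H(y)<\infty}\Big],\qquad y\in\mathbb{Z}^d.$$ Quenched Lyapunov exponent: if $\mathbb{E}[U(0)]<\infty$, it is known that there is a (unique) non-random norm $\alpha_U$ on $\mathbb{R}^d$ such that $\mathbb{P}$-a.s. for all $\ell\in\mathbb{Z}^d$, $$\alpha_U(\ell)=\lim_{k\to\infty}\frac{-\ln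 e(0,k\ell,U)}{k}=\lim_{k\to\infty}\frac{-\mathbb{E}[\ln e(0,k\ell,U)]}{k}.$$ The right-hand side of the claimed inequality may be infinite; the convention $\infty\cdot0=0$ is used when $\ell=0$. *)

(* Defs.v *)
From HB Require Import structures.
From mathcomp Require Export all_boot all_order all_algebra.
From mathcomp Require Export all_classical all_reals all_analysis.

Set Implicit Arguments.
Unset Strict Implicit.
Unset Printing Implicit Defensive.

Export Order.TTheory GRing.Theory Num.Theory.
Export numFieldNormedType.Exports.

Local Open Scope classical_set_scope.
Local Open Scope ring_scope.

Definition mutually_independent (disp : measure_display)
    (T : measurableType disp) (R : realType) (P : probability T R)
    (I : eqType) (F : I -> set_system T) : Prop :=
  forall (s : seq I) (A : I -> set T), uniq s ->
    (forall i, i \in s -> F i (A i)) ->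
    P (\bigcap_(i in [set` s]) A i) = (\prod_(i <- s) P (A i))%E.

Definition iid (disp : measure_display) (T : measurableType disp)
    (R : realType) (P : probability T R) (I : eqType)
    (X : I -> {RV P >-> R}) : Prop :=
  mutually_independent P
    (fun i => preimage_set_system setT (X i) measurable) /\
  forall (i j : I) (A : set R), measurable A ->
    P (X i @^-1` A) = P (X j @^-1` A).

(* ['rV[int]_d] carries the discrete sigma-algebra, so the sigma-algebra
   generated by an increment is the set of preimages of arbitrary subsets. *)
Record simple_random_walk (disp : measure_display) (W : measurableType disp)
    (R : realType) (Q : probability W R) (d : nat)
    (S : nat -> W -> 'rV[int]_d) : Prop := {
  srw_measurable : forall n y, measurable (S n @^-1` [set y]);
  srw_start : forall w, S 0%N w = 0;
  srw_indep : mutually_independent Q (fun n : nat =>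
    preimage_set_system setT (fun w => S n.+1 w - S n w) setT);
  srw_step : forall n (i : 'I_d),
    Q [set w | S n.+1 w - S n w = delta_mx 0 i] = ((2 * d)%:R^-1)%:E /\
    Q [set w | S n.+1 w - S n w = - delta_mx 0 i] = ((2 * d)%:R^-1)%:E }.

(* [None] stands for an infinite hitting time. *)
Definition hitting_time (d : nat) (s : nat -> 'rV[int]_d) (y : 'rV[int]_d) :
    option nat :=
  match pselect (exists n, s n == y) with
  | left h => Some (ex_minn h)
  | right _ => None
  end.

(* For [U] non-negative the integrand takes values in [0, 1], so the
   expectation is finite and [fine] loses nothing. *)
Definition green (disp : measure_display) (W : measurableType disp)
    (R : realType) (Q : probability W R) (d : nat)
    (S : nat -> W -> 'rV[int]_d) (U : 'rV[int]_d -> R) (y : 'rV[int]_d) : R :=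
  fine ('E_Q[fun w =>
    if hitting_time (S ^~ w) y is Some h
    then expR (- \sum_(0 <= n < h) U (S n w))%R else 0%R])%E.

Record is_norm (R : realType) (L : lmodType R) (N : L -> R) : Prop := {
  is_norm_ge0 : forall x, 0 <= N x;
  is_norm_eq0 : forall x, N x = 0 -> x = 0;
  is_normZ : forall a x, N (a *: x) = `|a| * N x;
  is_normD : forall x y, N (x + y) <= N x + N y }.

(* The matrix norm of the library is the sup norm. *)
Definition norm2 (R : realType) (d : nat) (x : 'rV[R]_d) : R :=
  Num.sqrt (\sum_(i < d) x 0 i ^+ 2).

(* Existence and uniqueness of such a norm, for an i.i.d. integrable
   potential, are classical; the norm is specified here by its defining
   property. *)
Record is_quenched_lyapunov (disp disp' : measure_display)
    (T : measurableType disp) (W : measurableType disp') (R : realType)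
    (P : probability T R) (Q : probability W R) (d : nat)
    (S : nat -> W -> 'rV[int]_d) (U : 'rV[int]_d -> {RV P >-> R})
    (alpha : 'rV[R]_d -> R) : Prop := {
  lyapunov_norm : is_norm alpha;
  lyapunov_ae : {ae P, forall w, forall l : 'rV[int]_d,
    (fun k : nat => - ln (green Q S (fun x => U x w) (l *+ k)) / k%:R)
      @ \oo --> alpha (map_mx intr l)};
  lyapunov_mean : forall l : 'rV[int]_d,
    (fun k : nat =>
      (- 'E_P[fun w => ln (green Q S (fun x => U x w) (l *+ k)%R)]
       * (k%:R^-1)%:E)%E)
      @ \oo --> (alpha (map_mx intr l))%:E }.

(* Main.v *)
Require Import Defs.
From mathcomp Require Import measurable_realfun ring lra.

Set Implicit Arguments.
Unset Strict Implicit.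
Unset Printing Implicit Defensive.

Local Open Scope classical_set_scope.
Local Open Scope ring_scope.

(** The inequality comes from a bound valid for each single gamma: with
    lambda the mean of the potential,
      alpha l <= sqrt (2 d (e^lambda - 1)) |l|_2     ([lyapunov_le_norm2]).
    As e^lambda - 1 ~ lambda when lambda -> 0, and lambda = O(gamma) whenever
    the right-hand side of the theorem is finite, taking upper limits gives
    the result.

    The bound needs no asymptotics of hitting times. A walk that is at y at
    time N has hit y by time N, so the Green function at y is at least the sum
    over the words of N steps that end at y of (2d)^-N exp (- cost). Jensen's
    inequality for these finitely many words, followed by integration over the
    potential, replaces every cost by its mean N lambda. Concatenating k words
    that end at y gives a word that ends at k y, so letting k tend to infinity
    yields, for all N and y,
      #{words of length N ending at y} <= (2 d e^lambda)^N e^(- alpha y),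
    which is [card_words_to_le].

    This is turned into an upper bound on alpha by convex duality. Since alpha
    is a norm, there is theta with theta . x <= alpha x for all x and equality
    at l ([supporting_functional]). Weighting a word ending at y by
    e^(theta . y) and summing over all words of length N gives
    (sum_i (e^theta_i + e^-theta_i))^N on the one hand; on the other hand, by
    the previous estimate, each class of words with the same numbers of steps
    of each kind contributes at most (2 d e^lambda)^N, and the number of
    classes is polynomial in N. Comparing growth rates,
      sum_i (e^theta_i + e^-theta_i) <= 2 d e^lambda    ([sum_tilt_le]),
    and as e^t + e^-t >= 2 + t^2 this means |theta|_2^2 <= 2 d (e^lambda - 1).
    Cauchy-Schwarz applied to alpha l = theta . l concludes. *)

(** * Supporting functionals of sublinear functions *)

Definition sublinear (R : realType) (E : lmodType R) (p : E -> R) : Prop :=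
  (forall x y, p (x + y) <= p x + p y) /\
  (forall a x, 0 <= a -> p (a *: x) = a * p x).

Lemma sublinear0 (R : realType) (E : lmodType R) (p : E -> R) :
  sublinear p -> p 0 = 0.
Proof. by case=> _ pZ; rewrite -(scale0r (0 : E)) pZ// mul0r. Qed.

Lemma sublinearN (R : realType) (E : lmodType R) (p : E -> R) (x : E) :
  sublinear p -> - p (- x) <= p x.
Proof.
move=> pS; have := pS.1 x (- x).
by rewrite subrr (sublinear0 pS) => h; lra.
Qed.

Lemma is_norm_sublinear (R : realType) (E : lmodType R) (N : E -> R) :
  is_norm N -> sublinear N.
Proof.
by case=> _ _ NZ ND; split=> // a x a0; rewrite NZ ger0_norm.
Qed.

(** One step of Hahn-Banach without subspaces: q x is the infimum over t >= 0
    of p (x + t e) - t p e, which lowers the slope of p in the direction -e as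
    far as possible. Linearity of q on the line through e then follows from
    q (- e) <= - p e. *)
Lemma sublinear_flatten (R : realType) (E : lmodType R) (p : E -> R) (e : E) :
  sublinear p -> exists q : E -> R,
    [/\ sublinear q, forall x, q x <= p x, q e = p e & q (- e) = - q e].
Proof.
move=> pS; have [pD pZ] := pS.
pose A x := [set p (x + t *: e) - t * p e | t in [set t : R | 0 <= t]].
pose q x := inf (A x).
have Alb x : lbound (A x) (- p (- x)).
  move=> _ [t /= t0 <-].
  have := pD (x + t *: e) (- x).
  by rewrite addrAC subrr add0r pZ// => h; lra.
have qlb x t : 0 <= t -> q x <= p (x + t *: e) - t * p e.
  move=> t0; apply: ge_inf; first by exists (- p (- x)).
  by exists t.
have leq_q x r : (forall t, 0 <= t -> r <= p (x + t *: e) - t * p e) -> r <= q x.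
  move=> h; apply: lb_le_inf; first by exists (p (x + 0 *: e) - 0 * p e), 0 => /=.
  by move=> _ [t /= t0 <-]; exact: h.
have qp x : q x <= p x.
  by have := qlb x 0 (lexx _); rewrite scale0r addr0 mul0r subr0.
have q0 : q 0 = 0.
  apply/eqP; rewrite eq_le; apply/andP; split.
    by rewrite -(sublinear0 pS) qp.
  by apply: (leq_q _) => t t0; rewrite add0r pZ// subrr.
have qD x y : q (x + y) <= q x + q y.
  rewrite -lerBlDr; apply: (leq_q _) => s s0.
  rewrite lerBlDr -lerBlDl; apply: (leq_q _) => t t0.
  have := qlb (x + y) (s + t) (addr_ge0 s0 t0).
  have := pD (x + s *: e) (y + t *: e).
  rewrite addrACA -scalerDl; set u := p (_ + (s + t) *: e) => h1 h2.
  by lra.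
have qZle a x : 0 < a -> q (a *: x) <= a * q x.
  move=> a0; rewrite mulrC -ler_pdivrMr//; apply: (leq_q _) => t t0.
  rewrite ler_pdivrMr//.
  have := qlb (a *: x) (a * t) (mulr_ge0 (ltW a0) t0).
  rewrite -scalerA -scalerDr pZ ?(ltW a0)// => h.
  by apply: (le_trans h); rewrite mulrBl mulrC lerD2l lerN2 -mulrA mulrC.
have qS : sublinear q.
  split=> // a x; rewrite le_eqVlt => /predU1P[<-|a0].
    by rewrite scale0r mul0r q0.
  apply/eqP; rewrite eq_le qZle//= -ler_pdivlMl//.
  have ai : 0 < a^-1 by rewrite invr_gt0.
  have := qZle _ (a *: x) ai.
  by rewrite scalerA mulVf ?gt_eqF// scale1r.
have qNe : q (- e) <= - p e.
  have := qlb (- e) 1 ler01.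
  by rewrite scale1r addNr (sublinear0 pS) mul1r sub0r.
have qe : q e = p e.
  apply/eqP; rewrite eq_le qp/=.
  have := sublinearN e qS; lra.
exists q; split=> //.
apply/eqP; rewrite eq_le qe qNe/= -qe.
have := sublinearN e qS; lra.
Qed.

(** Once q (- v) = - q v, any sublinear function below q agrees with q at v and
    - v, so the flattening steps do not undo each other. *)
Lemma sublinear_flatten_seq (R : realType) (E : lmodType R) (p : E -> R)
    (l : E) (s : seq E) :
  sublinear p -> exists q : E -> R,
    [/\ sublinear q, forall x, q x <= p x, q l = p l &
        forall e, e \in l :: s -> q (- e) = - q e].
Proof.
move=> pS; elim: s => [|e s [q [qS qp ql qN]]].
  have [q [qS qp ql qN]] := sublinear_flatten l pS.
  by exists q; split=> // e; rewrite inE => /eqP ->.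
have [r [rS rq re rN]] := sublinear_flatten e qS.
have keep v : q (- v) = - q v -> r v = q v /\ r (- v) = - r v.
  move=> qv; have := rq v; have := rq (- v).
  by have := sublinearN v rS; rewrite qv => h1 h2 h3; split; lra.
exists r; split=> //.
- by move=> x; rewrite (le_trans (rq x)).
- have ql' : q (- l) = - q l by rewrite qN// mem_head.
  by rewrite (keep _ ql').1.
- move=> v; rewrite !inE orbCA => /orP[/eqP -> //|vs].
  by apply: (keep v _).2; apply: qN; rewrite inE.
Qed.

Definition dotv (R : realType) (d : nat) (x y : 'rV[R]_d) : R :=
  \sum_(i < d) x 0 i * y 0 i.

(** Flattening p at l and along the canonical basis leaves a function below p
    that is linear, hence of the form dotv theta. *)
Lemma supporting_functional (R : realType) (d : nat) (p : 'rV[R]_d -> R)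
    (l : 'rV[R]_d) :
  sublinear p -> exists theta : 'rV[R]_d,
    (forall x, dotv theta x <= p x) /\ dotv theta l = p l.
Proof.
move=> pS.
have [q [qS qp ql qN]] :=
  sublinear_flatten_seq l [seq delta_mx 0 i | i <- enum 'I_d] pS.
have [qD qZ] := qS.
have qNe i : q (- delta_mx 0 i) = - q (delta_mx 0 i).
  by apply: qN; rewrite inE map_f ?orbT// mem_enum.
have qZe i a : q (a *: delta_mx 0 i) = a * q (delta_mx 0 i).
  case: (leP 0 a) => [a0|a0]; first by rewrite qZ.
  by rewrite -[a]opprK scaleNr -scalerN qZ ?qNe ?mulrN ?mulNr// oppr_ge0 ltW.
pose theta : 'rV[R]_d := \row_i q (delta_mx 0 i).
have le_dot x : q x <= dotv theta x.
  rewrite {1}[x]row_sum_delta /dotv.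
  apply: (@big_ind2 _ _ (fun u v => q u <= v)).
  - by rewrite (sublinear0 qS).
  - by move=> u a v b ua vb; rewrite (le_trans (qD _ _))// lerD.
  - by move=> i _; rewrite qZe mxE mulrC.
have dotN x : dotv theta (- x) = - dotv theta x.
  by rewrite /dotv -sumrN; apply: eq_bigr => i _; rewrite !mxE mulrN.
exists theta.
have dot_le x : q (- x) = - q x -> dotv theta x <= q x.
  move=> h; rewrite -lerN2 -dotN -h; exact: le_dot.
have dotE x : dotv theta x <= q x.
  have := le_dot (- x); rewrite dotN => h.
  by have := sublinearN x qS; lra.
split=> [x|]; first exact: le_trans (qp x).
apply/eqP; rewrite -ql eq_le le_dot dotE//.
Qed.

(** * Elementary inequalities *)

(** Cauchy-Schwarz, by the discriminant of the polynomial
    t |-> |t x - y|^2. *)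
Lemma dotv_le_norm2 (R : realType) (d : nat) (x y : 'rV[R]_d) :
  dotv x y <= norm2 x * norm2 y.
Proof.
set A := \sum_(i < d) x 0 i ^+ 2; set B := \sum_(i < d) y 0 i ^+ 2.
have A0 : 0 <= A by rewrite sumr_ge0// => i _; rewrite sqr_ge0.
have B0 : 0 <= B by rewrite sumr_ge0// => i _; rewrite sqr_ge0.
have quad t : 0 <= A * t ^+ 2 - 2 * dotv x y * t + B.
  have -> : A * t ^+ 2 - 2 * dotv x y * t + B =
      \sum_(i < d) (t * x 0 i - y 0 i) ^+ 2.
    rewrite /A /B /dotv mulr_suml -mulrA mulr_suml mulr_sumr -sumrB -big_split.
    by apply: eq_bigr => i _ /=; ring.
  by rewrite sumr_ge0// => i _; rewrite sqr_ge0.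
have disc : dotv x y ^+ 2 <= A * B.
  move: A0; rewrite le_eqVlt => /predU1P[Az|A0].
    rewrite -Az mul0r.
    suff -> : dotv x y = 0 by rewrite expr0n.
    rewrite /dotv big1// => i _; suff -> : x 0 i = 0 by rewrite mul0r.
    apply/eqP; rewrite -sqrf_eq0.
    have /eqP := esym Az; rewrite psumr_eq0; last by move=> j _; rewrite sqr_ge0.
    by move=> /allP/(_ i); rewrite mem_index_enum; exact.
  have := quad (dotv x y / A).
  rewrite -(ler_pM2l A0) mulr0.
  have -> : A * (A * (dotv x y / A) ^+ 2 - 2 * dotv x y * (dotv x y / A) + B) =
    A * B - dotv x y ^+ 2 by field; rewrite gt_eqF.
  by rewrite subr_ge0.
have n0 : 0 <= norm2 x * norm2 y by rewrite mulr_ge0 ?sqrtr_ge0.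
case: (leP 0 (dotv x y)) => [h|/ltW h]; last exact: le_trans n0.
rewrite -(@ler_pXn2r _ 2)// ?nnegrE// exprMn !sqr_sqrtr//.
Qed.

(** With b = e^(x/2), the difference of the two sides is (b - 1/b)^2 - x^2, so
    it suffices to bound e^y - e^-y below by 2 y for y >= 0. The second-order
    Taylor polynomial u of e^y is enough for that: u - 1/u >= 2 y amounts to
    y^4 / 4 >= 0. *)
Lemma expRDN_ge (R : realType) (x : R) :
  2 + x ^+ 2 <= expR x + expR (- x).
Proof.
have quad (y : R) : 0 <= y -> 1 + y + y ^+ 2 / 2 <= expR y.
  move=> y0.
  have := @nondecreasing_cvgn_le _ (series (exp_coeff y)) _ (is_cvg_series_exp_coeff y) 3.
  rewrite /series/= /exp_coeff/= !big_nat_recr//= big_nil !factS fact0.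
  rewrite expr0 expr1 !divr1 add0r; apply.
  apply/nondecreasing_seqP => n; rewrite big_nat_recr//= lerDl.
  by rewrite divr_ge0// exprn_ge0.
have sinh_ge (y : R) : 0 <= y -> 2 * y <= expR y - expR (- y).
  move=> y0; set u := 1 + y + y ^+ 2 / 2.
  have u0 : 0 < u by rewrite /u; nra.
  have := quad _ y0; rewrite -/u => uy.
  have hN : expR (- y) <= u^-1 by rewrite expRN lef_pV2// posrE// expR_gt0.
  have : 2 * y <= u - u^-1.
    rewrite lerBrDr -lerBrDl -[u^-1]mul1r ler_pdivrMr//.
    have -> : (u - 2 * y) * u = 1 + y ^+ 4 / 4 by rewrite /u; field.
    by rewrite lerDl divr_ge0// exprn_ge0.
  by lra.
wlog x0 : x / 0 <= x => [h|].
  case: (leP 0 x) => [/h//|x0].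
  by have := h (- x); rewrite oppr_ge0 sqrrN opprK addrC [X in _ -> _ <= X]addrC => -> //; exact: ltW.
have x2 : 0 <= x / 2 by lra.
have h := sinh_ge _ x2.
have e1 : expR x = expR (x / 2) ^+ 2 by rewrite -expRM_natl; congr expR; lra.
have e2 : expR (- x) = expR (- (x / 2)) ^+ 2 by rewrite -expRM_natl; congr expR; lra.
have e3 : expR (x / 2) * expR (- (x / 2)) = 1 by rewrite -expRD subrr expR0.
rewrite e1 e2.
move: e3 h; set a := expR _; set b := expR _ => ab h.
nra.
Qed.

Lemma le1_of_polynomial_growth (R : realType) (x : R) (m : nat) :
  (forall n : nat, x ^+ n <= (n.+1%:R) ^+ m) -> x <= 1.
Proof.
move=> h; rewrite leNgt; apply/negP => x1.
have : forall n : nat, x ^+ n <= n.+1%:R ^+ m.+1.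
  (* A positive exponent is needed to take roots below. *)
  move=> n; apply: (le_trans (h n)).
  by rewrite exprS ler_peMl// ?exprn_ge0// ler1n.
move: m {h} => m h.
pose t := x - 1; have t0 : 0 < t by rewrite subr_gt0.
have bern (n : nat) : 1 + n%:R * t <= x ^+ n.
  elim: n => [|n ih]; first by rewrite mul0r addr0 expr0.
  rewrite exprS (le_trans (_ : _ <= x * (1 + n%:R * t)))//; last first.
    by rewrite ler_pM2l// (lt_trans _ x1).
  have -> : x = 1 + t by rewrite /t; lra.
  rewrite -natr1; have : 0 <= n%:R * t * t by rewrite !mulr_ge0// ltW.
  by lra.
(* Evaluating at the exponent 2 (m + 1) n lets the (m + 1)-th root be taken on
   both sides: a quadratic function of n is then bounded by an affine one. *)
have key (n : nat) : (1 + n%:R * t) ^+ 2 <= (2 * m.+1 * n).+1%:R.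
  rewrite -(@ler_pXn2r _ m.+1)// ?nnegrE ?exprn_ge0// ?addr_ge0 ?mulr_ge0 ?(ltW t0)//.
  rewrite -exprM; apply: le_trans (h _).
  rewrite [in leRHS]mulnC [in leRHS]exprM; apply: lerXn2r => //; rewrite ?nnegrE.
  + by rewrite addr_ge0// mulr_ge0 ?(ltW t0).
  + by rewrite exprn_ge0// ltW// (lt_trans _ x1).
pose c : R := (2 * m.+1)%:R.
have [n hn] : exists n : nat, c / (t ^+ 2) < n%:R.
  exists (Num.trunc (c / t ^+ 2)).+1; apply: truncnS_gt.
have := key n; rewrite -natr1 natrM -/c.
move: hn; rewrite ltr_pdivrMr ?exprn_gt0// => hn hk.
have n0 : 0 <= (n%:R : R) by [].
have : 0 < n%:R :> R.
  rewrite lt_neqAle n0 andbT; apply/eqP => n0'; move: hn; rewrite -n0' mul0r.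
  by rewrite ltNge /c ler0n.
move=> np.
have : n%:R * c < n%:R * (n%:R * t ^+ 2) by rewrite ltr_pM2l.
have : 0 <= n%:R * t by rewrite mulr_ge0// ltW.
rewrite sqrrD expr1n mul1r exprMn in hk; nra.
Qed.

(** * Words of steps and their exponential moments *)

Definition step (d : nat) : finType := ('I_d * bool)%type.

Definition step_vec (d : nat) (u : step d) : 'rV[int]_d :=
  if u.2 then delta_mx 0 u.1 else - delta_mx 0 u.1.

Definition endpoint (d : nat) (s : seq (step d)) : 'rV[int]_d :=
  \sum_(u <- s) step_vec u.

Definition words_to (d N : nat) (y : 'rV[int]_d) : {set N.-tuple (step d)} :=
  [set s : N.-tuple (step d) | endpoint s == y].

Lemma card_step (d : nat) : #|{: step d}| = (2 * d)%N.
Proof. by rewrite card_prod card_ord card_bool mulnC. Qed.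

Lemma endpoint_cat (d : nat) (s t : seq (step d)) :
  endpoint (s ++ t) = endpoint s + endpoint t.
Proof. exact: big_cat. Qed.

Lemma card_words_to_mul (d N M : nat) (y z : 'rV[int]_d) :
  (#|words_to N y| * #|words_to M z| <= #|words_to (N + M) (y + z)|)%N.
Proof.
rewrite -cardsX.
pose f (p : N.-tuple (step d) * M.-tuple (step d)) := [tuple of p.1 ++ p.2].
have f_inj : injective f.
  move=> [s t] [s' t'] /(congr1 val)/= /eqP.
  rewrite eqseq_cat ?size_tuple// => /andP[/eqP/val_inj -> /eqP/val_inj ->].
  by [].
rewrite -(card_imset _ f_inj); apply/subset_leq_card/fintype.subsetP => _ /imsetP[[s t] + ->].
rewrite !inE /= => /andP[/eqP <- /eqP <-].
by rewrite endpoint_cat.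
Qed.

Lemma card_words_to_exp (d N k : nat) (y : 'rV[int]_d) :
  (#|words_to N y| ^ k <= #|words_to (k * N) (y *+ k)|)%N.
Proof.
elim: k => [|k ih].
  rewrite expn0 mul0n mulr0n card_gt0; apply/set0Pn; exists [tuple].
  by rewrite inE /endpoint big_nil.
rewrite expnS mulSn mulrS; apply: leq_trans (card_words_to_mul _ _ _ _).
by rewrite leq_mul2l ih orbT.
Qed.

(** The multinomial expansion, indexed by words. *)
Lemma sum_tuple_prod (R : comNzRingType) (A : finType) (F : A -> R) (N : nat) :
  \sum_(s : N.-tuple A) \prod_(u <- s) F u = (\sum_u F u) ^+ N.
Proof.
elim: N => [|N ih].
  rewrite (big_pred1 [tuple]); first by rewrite big_nil.
  by move=> s; apply/esym/eqP; rewrite (tuple0 s).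
rewrite exprS -ih big_distrlr /= pair_big /=.
rewrite (reindex (fun p : A * N.-tuple A => [tuple of p.1 :: p.2])) /=.
  by apply: eq_bigr => -[u s] _ /=; rewrite big_cons.
exists (fun s : N.+1.-tuple A => (thead s, [tuple of behead s])).
- by move=> [u s] _ /=; congr pair; apply: val_inj.
- by move=> s _; rewrite -tuple_eta.
Qed.

Lemma endpoint_perm (d : nat) (s t : seq (step d)) :
  perm_eq s t -> endpoint s = endpoint t.
Proof. exact: perm_big. Qed.

(** The class of a word up to reordering. There are only (N + 1)^(2 d) values,
    which is all that the counting argument asks of it. *)
Definition step_count (d N : nat) (s : N.-tuple (step d)) :
    {ffun step d -> 'I_N.+1} :=
  [ffun u => inord (count_mem u s)].

Lemma step_count_endpoint (d N : nat) (s t : N.-tuple (step d)) :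
  step_count s = step_count t -> endpoint s = endpoint t.
Proof.
move=> /ffunP st; apply: endpoint_perm; apply/allP => u _ /=.
have count_lt (r : N.-tuple (step d)) : (count_mem u r < N.+1)%N.
  by rewrite ltnS; have := count_size (pred1 u) r; rewrite size_tuple.
by have := congr1 val (st u); rewrite !ffunE /= !inordK// => ->.
Qed.

Section exponential_moment.
Context (R : realType) (d : nat) (theta : 'rV[R]_d).

Definition tilt (y : 'rV[int]_d) : R := expR (dotv theta (map_mx intr y)).

Lemma tilt_endpoint (s : seq (step d)) :
  tilt (endpoint s) = \prod_(u <- s) tilt (step_vec u).
Proof.
rewrite /tilt /endpoint -expR_sum; congr expR.
rewrite raddf_sum /dotv.
under eq_bigr do rewrite summxE mulr_sumr.
by rewrite exchange_big.
Qed.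

Lemma sum_tilt_step :
  \sum_(u : step d) tilt (step_vec u) =
  \sum_(i < d) (expR (theta 0 i) + expR (- theta 0 i)).
Proof.
rewrite -(pair_bigA _ (fun i b => tilt (step_vec (i, b)))) /=.
have dot_delta i : dotv theta (map_mx intr (delta_mx 0 i)) = theta 0 i.
  rewrite /dotv (bigD1 i)//= !mxE !eqxx mulr1 big1 ?addr0// => j ji.
  by rewrite !mxE (negbTE ji) andbF mulr0.
apply: eq_bigr => i _; rewrite big_bool /tilt /step_vec /= dot_delta.
congr (_ + expR _); rewrite raddfN -[in RHS]dot_delta /dotv -sumrN.
by apply: eq_bigr => j _; rewrite !mxE mulrN.
Qed.

(** Group the words by step counts: all words of a class have the same
    endpoint y, so a class contributes at most K^N e^(theta . y - a y) <= K^N.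
    Hence, with Z the sum over one step, (Z / K)^N grows at most
    polynomially in N. *)
Lemma sum_tilt_le (K : R) (a : 'rV[int]_d -> R) :
  0 < K ->
  (forall y, dotv theta (map_mx intr y) <= a y) ->
  (forall N y, (#|words_to N y|%:R <= K ^+ N * expR (- a y))) ->
  \sum_(u : step d) tilt (step_vec u) <= K.
Proof.
move=> K0 theta_a count_le.
set Z := \sum_u _.
suff : Z / K <= 1 by rewrite ler_pdivrMr// mul1r.
apply: (@le1_of_polynomial_growth _ _ #|{: step d}|) => N.
rewrite expr_div_n ler_pdivrMr ?exprn_gt0//.
rewrite -sum_tuple_prod.
under eq_bigr do rewrite -tilt_endpoint.
rewrite (partition_big (@step_count d N) predT)//.
rewrite -natrX -[N.+1 in leRHS]card_ord -card_ffun mulr_natl -sumr_const.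
apply: ler_sum => c _.
have [s0 /eqP s0c|no_s] := pickP (fun s => step_count s == c); last first.
  by rewrite big_pred0// exprn_ge0// ltW.
pose y := endpoint s0.
rewrite (eq_bigr (fun=> tilt y)); last first.
  move=> s sc; have {}sc : step_count s = c by exact/eqP.
  by congr tilt; apply: step_count_endpoint; rewrite sc.
rewrite sumr_const -mulr_natl.
apply: (@le_trans _ _ (#|words_to N y|%:R * tilt y)).
  rewrite ler_wpM2r ?expR_ge0// ler_nat subset_leq_card//.
  apply/fintype.subsetP => s; move=> sc; rewrite inE.
  have {}sc : step_count s = c by exact/eqP.
  by apply/eqP/step_count_endpoint; rewrite sc.
apply: (le_trans (ler_wpM2r (expR_ge0 _) (count_le N y))).
rewrite -mulrA ler_piMr ?exprn_ge0 ?(ltW K0)//.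
by rewrite /tilt -expRD -[leRHS]expR0 ler_expR addrC subr_le0.
Qed.

(** The second-order lower bound of the exponential moment of one step turns
    [sum_tilt_le] into a bound on the length of theta. *)
Lemma sqr_norm2_le (K : R) (a : 'rV[int]_d -> R) :
  0 < K ->
  (forall y, dotv theta (map_mx intr y) <= a y) ->
  (forall N y, (#|words_to N y|%:R <= K ^+ N * expR (- a y))) ->
  norm2 theta ^+ 2 <= K - (2 * d)%:R.
Proof.
move=> K0 theta_a count_le.
rewrite lerBrDr; apply: le_trans (sum_tilt_le K0 theta_a count_le).
rewrite sum_tilt_step sqr_sqrtr; last by rewrite sumr_ge0// => i _; rewrite sqr_ge0.
have -> : (2 * d)%:R = \sum_(i < d) 2 :> R.
  by rewrite sumr_const card_ord natrM mulr_natr.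
rewrite -big_split; apply: ler_sum => i _ /=.
by rewrite addrC expRDN_ge.
Qed.

End exponential_moment.

(** * Lower bounds on the Green function *)

(** Monotonicity of the integral that asks for no measurability: the Green
    function and its logarithm can be estimated without studying how they
    depend on the sample point. *)
Lemma ge0_le_integralT (disp : measure_display) (T : measurableType disp)
    (R : realType) (mu : {measure set T -> \bar R}) (f g : T -> \bar R) :
  (forall x, (0 <= f x)%E) -> (forall x, (f x <= g x)%E) ->
  (\int[mu]_x f x <= \int[mu]_x g x)%E.
Proof.
move=> f0 fg.
have g0 x : (0 <= g x)%E by exact: le_trans (fg x).
rewrite !ge0_integralTE//; apply: ge_ereal_sup => _ [h hf <-].
by apply: ereal_sup_ubound; exists h => // x; exact: le_trans (fg x).
Qed.

Section walk.
Context (disp : measure_display) (W : measurableType disp) (R : realType)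
  (Q : probability W R) (d : nat) (S : nat -> W -> 'rV[int]_d).
Hypothesis hd : (1 <= d)%N.
Hypothesis hS : simple_random_walk Q S.

Definition follows (s : seq (step d)) : set W :=
  [set w | forall n, (n <= size s)%N -> S n w = endpoint (take n s)].

Lemma endpoint_takeS (s : seq (step d)) (n : nat) : (n < size s)%N ->
  exists u, take n.+1 s = rcons (take n s) u /\
            endpoint (take n.+1 s) - endpoint (take n s) = step_vec u.
Proof.
case: s => // u0 s ns; exists (nth u0 (u0 :: s) n).
rewrite (take_nth u0 ns); split=> //.
by rewrite -cats1 endpoint_cat /endpoint big_seq1 addrAC subrr add0r.
Qed.

Lemma step_vec_inj : injective (@step_vec d).
Proof.
move=> [i b] [j c] /= /rowP/(_ i); rewrite /step_vec /=.
by case: b; case: c; rewrite !mxE !eqxx /=; case: (eqVneq i j) => [->|_] // /eqP.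
Qed.

Lemma follows_inj (s t : seq (step d)) (w : W) :
  size s = size t -> follows s w -> follows t w -> s = t.
Proof.
move=> st fs ft.
suff take_eq n : (n <= size s)%N -> take n s = take n t.
  by have := take_eq _ (leqnn _); rewrite take_size {1}st take_size.
elim: n => [|n ih] ns; first by rewrite !take0.
have [u [su eu]] := endpoint_takeS ns.
have nt : (n < size t)%N by rewrite -st.
have [v [tv ev]] := endpoint_takeS nt.
rewrite su tv ih ?(ltnW ns)//; congr rcons; apply: step_vec_inj.
by rewrite -eu -ev -!fs ?(ltnW ns)// -!ft ?(ltnW nt).
Qed.

Lemma measurable_follows (s : seq (step d)) : measurable (follows s).
Proof.
have -> : follows s = \bigcap_(n in [set n | (n <= size s)%N])
    (S n @^-1` [set endpoint (take n s)]) by [].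
by apply: bigcap_measurable => [|n _]; [exists 0%N | exact: srw_measurable hS _ _].
Qed.

(** Rewrites the event in terms of increments, to which independence
    applies. *)
Lemma follows_increments (s : seq (step d)) :
  follows s = \bigcap_(n in [set` iota 0 (size s)])
    [set w | S n.+1 w - S n w = endpoint (take n.+1 s) - endpoint (take n s)].
Proof.
apply/seteqP; split=> w /= fw.
  by move=> n /=; rewrite mem_iota => /andP[_ ns]; rewrite !fw// ltnW.
elim=> [|n ih] ns; first by rewrite (srw_start hS) take0 /endpoint big_nil.
have := fw n; rewrite /= mem_iota /= add0n => /(_ ns) /eqP.
by rewrite ih 1?ltnW// (inj_eq (addIr _)) => /eqP.
Qed.

Lemma prob_follows (s : seq (step d)) :
  Q (follows s) = (((2 * d)%:R ^- size s)%R)%:E.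
Proof.
rewrite follows_increments (srw_indep hS) ?iota_uniq//; last first.
  move=> n _; exists [set endpoint (take n.+1 s) - endpoint (take n s)] => //.
  by rewrite setTI.
rewrite big_seq (eq_bigr (fun=> ((2 * d)%:R^-1)%:E)); last first.
  move=> n; rewrite mem_iota add0n => /andP[_ ns].
  have [[i b] [_ ->]] := endpoint_takeS ns.
  have [h1 h2] := srw_step hS n i.
  by case: b; rewrite /step_vec /= ?h1 ?h2.
rewrite -big_seq -exprVn -[in RHS](size_iota 0 (size s)).
elim: (iota _ _) => [|n r ih]; first by rewrite big_nil expr0.
by rewrite big_cons ih -EFinM exprS.
Qed.

Definition path_cost (U : 'rV[int]_d -> R) (s : seq (step d)) : R :=
  \sum_(0 <= n < size s) U (endpoint (take n s)).

Definition green_integrand (U : 'rV[int]_d -> R) (y : 'rV[int]_d) (w : W) : R :=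
  if hitting_time (S ^~ w) y is Some h
  then expR (- \sum_(0 <= n < h) U (S n w)) else 0.

Section bounds.
Variables (U : 'rV[int]_d -> R) (U0 : forall x, 0 <= U x).

Lemma green_integrand_ge0 y w : 0 <= green_integrand U y w.
Proof.
by rewrite /green_integrand; case: hitting_time => // h; exact: expR_ge0.
Qed.

Lemma green_integrand_le1 y w : green_integrand U y w <= 1.
Proof.
rewrite /green_integrand; case: hitting_time => // h.
by rewrite -[leRHS]expR0 ler_expR oppr_le0 sumr_ge0.
Qed.

(** Following s leads to y at time N at the latest, and stopping earlier only
    removes nonnegative terms from the cost. *)
Lemma green_integrand_ge (N : nat) y (s : N.-tuple (step d)) w :
  s \in words_to N y -> follows s w ->
  expR (- path_cost U s) <= green_integrand U y w.
Proof.
rewrite inE => /eqP sy fs; rewrite /green_integrand /hitting_time.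
have SN : S N w == y.
  by rewrite fs ?size_tuple// take_oversize ?size_tuple// sy.
case: pselect => [hit|]; last by case; exists N.
case: ex_minnP => h _ hmin; have hN := hmin _ SN.
rewrite ler_expR lerN2 /path_cost size_tuple.
rewrite (@big_cat_nat _ _ _ h 0 N)//= -[leLHS]addr0 lerD//; last by rewrite sumr_ge0.
rewrite le_eqVlt; apply/orP; left; apply/eqP.
rewrite !big_nat; apply: eq_bigr => n /andP[_ nh].
by rewrite fs// size_tuple (leq_trans (ltnW nh)).
Qed.

Lemma green_fin y : (green Q S U y)%:E = (\int[Q]_w (green_integrand U y w)%:E)%E.
Proof.
rewrite /green unlock fineK// fin_numElt; apply/andP; split.
  apply: (@lt_le_trans _ _ 0%E); first by rewrite ltNyr.
  by apply: integral_ge0 => w _; rewrite lee_fin green_integrand_ge0.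
apply: (@le_lt_trans _ _ (\int[Q]_w cst 1%E w)%E); last first.
  by rewrite integral_cst//= probability_setT mule1 ltry.
apply: ge0_le_integralT => w; first by rewrite lee_fin green_integrand_ge0.
by rewrite lee_fin green_integrand_le1.
Qed.

Lemma green_le1 y : green Q S U y <= 1.
Proof.
rewrite -lee_fin green_fin.
apply: (@le_trans _ _ (\int[Q]_w cst 1%E w)%E); last first.
  by rewrite integral_cst//= probability_setT mule1.
apply: ge0_le_integralT => w; first by rewrite lee_fin green_integrand_ge0.
by rewrite lee_fin green_integrand_le1.
Qed.

(** The walk follows at most one word of length N, so the events of
    following the different words contribute additively. *)
Lemma green_ge (N : nat) y :
  (2 * d)%:R ^- N * \sum_(s in words_to N y) expR (- path_cost U s)
  <= green Q S U y.
Proof.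
rewrite -lee_fin green_fin mulr_sumr -big_enum/=.
pose g (s : N.-tuple (step d)) w : \bar R :=
  ((expR (- path_cost U s))%:E * (\1_(follows s) w)%:E)%E.
have mind (s : N.-tuple (step d)) : measurable_fun setT (fun w => (\1_(follows s) w)%:E).
  by apply/measurable_EFinP; apply: measurable_indic; exact: measurable_follows.
have g0 s w : (0 <= g s w)%E by rewrite mule_ge0// lee_fin ?expR_ge0.
apply: (@le_trans _ _ (\int[Q]_w \sum_(s <- enum (words_to N y)) g s w)%E).
  rewrite ge0_integral_sum//; last first.
    by move=> s; apply: emeasurable_funM; [exact: measurable_cst | exact: mind].
  rewrite -sumEFin lee_sum// => s _; rewrite ge0_integralZl_EFin// ?expR_ge0//.
  rewrite integral_indic//=; last exact: measurable_follows.
  by rewrite setIT prob_follows size_tuple -EFinM mulrC.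
apply: ge0_le_integralT => w; first by rewrite sume_ge0.
have [[s sy fs]|none] := pselect (exists2 s, s \in words_to N y & follows s w); last first.
  rewrite big_enum big1 /= ?lee_fin ?green_integrand_ge0// => s sy.
  rewrite /g indicE memNset ?mule0// => fs; apply: none; by exists s.
rewrite big_enum (bigD1 s)//= big1 ?adde0.
  rewrite /g indicE mem_set// mule1 lee_fin.
  exact: green_integrand_ge.
move=> t /andP[_ ts]; rewrite /g indicE memNset ?mule0// => ft.
move/eqP: ts; apply; apply: val_inj; apply: follows_inj ft fs.
by rewrite !size_tuple.
Qed.

(** Jensen's inequality for the uniform distribution on the words ending at y,
    proved by expanding e^(avg - cost) >= 1 + (avg - cost), whose deviations
    sum to zero. *)
Lemma oppr_ln_green_le (N : nat) y (m := #|words_to N y|) :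
  (0 < m)%N ->
  - ln (green Q S U y) <=
    N%:R * ln (2 * d)%:R - ln m%:R +
    m%:R^-1 * \sum_(s in words_to N y) path_cost U s.
Proof.
move=> m0; have mR : 0 < m%:R :> R by rewrite ltr0n.
have dR : 0 < (2 * d)%:R :> R by rewrite ltr0n muln_gt0.
set avg := _^-1 * _.
have jensen : m%:R * expR (- avg) <=
    \sum_(s in words_to N y) expR (- path_cost U s).
  apply: (@le_trans _ _ (\sum_(s in words_to N y)
      expR (- avg) * (1 + (avg - path_cost U s)))).
    rewrite -mulr_sumr big_split/= sumrB !sumr_const -/m.
    rewrite -[avg *+ m]mulr_natl /avg mulrA divff ?gt_eqF// mul1r subrr addr0.
    by rewrite mulrC.
  apply: ler_sum => s _.
  have {2}-> : - path_cost U s = - avg + (avg - path_cost U s) by ring.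
  by rewrite expRD ler_wpM2l ?expR_ge0// expR_ge1Dx.
have pos : 0 < (2 * d)%:R ^- N * (m%:R * expR (- avg)).
  by rewrite !mulr_gt0 ?expR_gt0// invr_gt0 exprn_gt0.
have low : (2 * d)%:R ^- N * (m%:R * expR (- avg)) <= green Q S U y.
  apply: le_trans (green_ge N y).
  by rewrite ler_wpM2l// invr_ge0 exprn_ge0// ltW.
have g0 : 0 < green Q S U y by exact: lt_le_trans low.
have := low; rewrite -ler_ln ?posrE// lnM ?posrE ?mulr_gt0 ?invr_gt0 ?exprn_gt0 ?expR_gt0//.
rewrite lnM ?posrE ?expR_gt0// lnV ?posrE ?exprn_gt0// lnXn// expRK -mulr_natl.
by lra.
Qed.

End bounds.

Section averaged.
Context (disp' : measure_display) (T : measurableType disp')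
  (P : probability T R) (V : 'rV[int]_d -> {RV P >-> R}).
Hypothesis V_iid : iid V.
Hypothesis V_ge0 : forall x w, 0 <= V x w.
Hypothesis V_int : ('E_P[V 0%R] < +oo)%E.

Let lambda := fine 'E_P[V 0%R].

(** The absolute value coincides with the identity on the range of V x, and it
    is nonnegative on the whole line, as the transfer formula asks. *)
Lemma iid_expectation x : (\int[P]_w (V x w)%:E)%E = lambda%:E.
Proof.
have -> : lambda%:E = (\int[P]_w (V 0%R w)%:E)%E.
  rewrite /lambda fineK; first by rewrite unlock.
  by rewrite ge0_fin_numE// expectation_ge0.
pose f (r : R) : \bar R := `|r|%:E.
have mf : measurable_fun setT f.
  by apply/measurable_EFinP; exact: normr_measurable.
have E z : (\int[P]_w (V z w)%:E = \int[distribution P (V z)]_r f r)%E.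
  rewrite ge0_integral_distribution//; last by move=> r; rewrite lee_fin.
  by apply: eq_integral => w _; rewrite /f /= ger0_norm.
rewrite !E; apply: eq_measure_integral => A mA _.
exact: V_iid.2.
Qed.

(** A word of length N pays for N visits, each of mean lambda, so the mean cost
    is N lambda for all words, however often they revisit a site. The bound of
    [oppr_ln_green_le] is nonnegative because there are at most (2 d)^N
    words, which allows integrating it term by term. *)
Lemma expectation_ln_green_le (N : nat) y (m := #|words_to N y|) :
  (0 < m)%N ->
  (- 'E_P[fun w => ln (green Q S (fun x => V x w) y)] <=
   (N%:R * ln (2 * d)%:R - ln m%:R + N%:R * lambda)%:E)%E.
Proof.
move=> m0; have mR : 0 < m%:R :> R by rewrite ltr0n.
have dR : 1 <= (2 * d)%:R :> R by rewrite ler1n muln_gt0.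
set b := N%:R * _ - _.
have b0 : 0 <= b.
  rewrite subr_ge0 mulr_natl -lnXn ?(lt_le_trans ltr01)// ler_ln ?posrE//; last first.
    by rewrite exprn_gt0// (lt_le_trans ltr01).
  rewrite -natrX ler_nat -card_step -card_tuple; exact: max_card.
have Vint0 w x : (0 <= (V x w)%:E)%E by rewrite lee_fin.
rewrite unlock.
pose F w : \bar R := (- ln (green Q S (fun x => V x w) y))%:E.
have F0 w : (0 <= F w)%E.
  by rewrite lee_fin oppr_ge0 ln_le0// green_le1.
have -> : (- (\int[P]_w (ln (green Q S (fun x => V x w) y))%:E) =
    \int[P]_w F w)%E.
  have -> : (\int[P]_w (ln (green Q S (fun x => V x w) y))%:E =
      \int[P]_w - F w)%E.
    by apply: eq_integral => w _; rewrite /F -EFinN opprK.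
  by rewrite integral_ge0N ?oppeK.
pose cost w := (\sum_(s <- enum (words_to N y))
   \sum_(n <- iota 0 N) (V (endpoint (take n s)) w)%:E)%E.
have mV x : measurable_fun setT (fun w => (V x w)%:E).
  by apply/measurable_EFinP; exact: measurable_funP.
have cost0 w : (0 <= cost w)%E.
  by rewrite /cost; apply: sume_ge0 => s _; apply: sume_ge0 => n _.
have mcost : measurable_fun setT cost.
  by apply: emeasurable_sum => s; apply: emeasurable_sum => n.
have int_cost : (\int[P]_w cost w)%E = (m%:R * (N%:R * lambda))%:E.
  rewrite /cost ge0_integral_sum//; last 2 first.
    by move=> s; apply: emeasurable_sum => n.
    by move=> s w _; apply: sume_ge0 => n _.
  rewrite big_enum/= (eq_bigr (fun=> (N%:R * lambda)%:E)).
    by rewrite sumEFin sumr_const -[(_ * _) *+ _]mulr_natl.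
  move=> s _; rewrite ge0_integral_sum//.
  under eq_bigr do rewrite iid_expectation.
  by rewrite sumEFin big_const_seq count_predT size_iota iter_addr addr0 -[lambda *+ N]mulr_natl.
apply: (@le_trans _ _ (\int[P]_w (b%:E + (m%:R^-1)%:E * cost w))%E).
  apply: ge0_le_integralT => // w.
  have := @oppr_ln_green_le (fun x => V x w) (fun x => V_ge0 x w) N y m0.
  rewrite -lee_fin => /le_trans; apply.
  rewrite EFinD EFinM leeD2l// lee_pmul2l// ?lte_fin ?invr_gt0//.
  rewrite /cost big_enum/= -sumEFin lee_sum// => s _.
  by rewrite sumEFin /path_cost size_tuple /index_iota subn0.
rewrite ge0_integralD//; last 2 first.
- by move=> w _; rewrite mule_ge0// lee_fin invr_ge0 ltW.
- by apply: emeasurable_funM; [exact: measurable_cst | exact: mcost].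
rewrite integral_cst//= probability_setT mule1 ge0_integralZl_EFin//.
rewrite int_cost -EFinM mulKf ?gt_eqF// -EFinD//.
Qed.

(** [expectation_ln_green_le] at k y with words of length k N is, by
    supermultiplicativity of the word counts, at most k times a constant;
    dividing by k gives alpha y in the limit. *)
Lemma card_words_to_le (alpha : 'rV[R]_d -> R) (N : nat) y :
  is_quenched_lyapunov Q S V alpha ->
  #|words_to N y|%:R <=
    ((2 * d)%:R * expR lambda) ^+ N * expR (- alpha (map_mx intr y)).
Proof.
move=> halpha; have dR : 0 < (2 * d)%:R :> R by rewrite ltr0n muln_gt0.
have [->|m0] := posnP #|words_to N y|.
  by rewrite mulr_ge0 ?exprn_ge0 ?mulr_ge0 ?expR_ge0// ltW.
have mR : 0 < #|words_to N y|%:R :> R by rewrite ltr0n.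
set B := N%:R * ln (2 * d)%:R - ln #|words_to N y|%:R + N%:R * lambda.
suff alphaB : alpha (map_mx intr y) <= B.
  rewrite -ler_ln ?posrE// ?mulr_gt0 ?exprn_gt0 ?mulr_gt0 ?expR_gt0//.
  rewrite lnM ?posrE ?exprn_gt0 ?mulr_gt0 ?expR_gt0//.
  rewrite lnXn ?mulr_gt0 ?expR_gt0// lnM ?posrE ?expR_gt0// !expRK -[(_ + _) *+ N]mulr_natl.
  by move: alphaB; rewrite /B; lra.
rewrite -lee_fin; apply: (cvge_to_le (lyapunov_mean halpha (l := y))).
near=> k.
have k0 : (0 < k)%N by near: k; exact: nbhs_infty_gt.
have kR : 0 < k%:R :> R by rewrite ltr0n.
rewrite muleC -(@lee_pmul2l _ k%:R%:E) ?lte_fin// muleA -EFinM divff ?gt_eqF// mul1e.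
have mk := card_words_to_exp N k y.
have mk0 : (0 < #|words_to (k * N) (y *+ k)|)%N.
  by apply: leq_trans mk; rewrite expn_gt0 m0.
apply: (le_trans (expectation_ln_green_le mk0)).
rewrite -EFinM lee_fin /B natrM.
have : ln (#|words_to N y|%:R ^+ k) <= ln #|words_to (k * N) (y *+ k)|%:R :> R.
  by rewrite ler_ln ?posrE ?ltr0n ?exprn_gt0// -natrX ler_nat.
rewrite lnXn// -[ln _ *+ k]mulr_natl; lra.
Unshelve. all: by end_near. Qed.

End averaged.
End walk.

(** * Comparison of the upper limits *)

Lemma limf_esup_le (R : realType) (T : choiceType) (X : filteredType T) (f : X -> \bar R)
    (F : set_system X) (b : \bar R) :
  F [set x | (f x <= b)%E] -> (limf_esup f F <= b)%E.
Proof.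
move=> Fb; rewrite limf_esupE; apply: ge_ereal_inf.
exists (ereal_sup (f @` [set x | (f x <= b)%E])); first by exists [set x | (f x <= b)%E].
by apply: ge_ereal_sup => _ [x /= fx <-].
Qed.

Lemma limf_esup_lt (R : realType) (T : choiceType) (X : filteredType T) (f : X -> \bar R)
    (F : set_system X) (FF : Filter F) (b : \bar R) :
  (limf_esup f F < b)%E -> F [set x | (f x <= b)%E].
Proof.
rewrite limf_esupE => /ereal_inf_lt[_ [A FA <-] /ltW supb].
apply: filterS FA => x Ax /=; apply: le_trans supb.
by apply: ereal_sup_ubound; exists x.
Qed.

(** The functional supporting alpha at l is bounded by [sqr_norm2_le] with
    K = 2 d e^lambda, whose hypotheses are the choice of theta and
    [card_words_to_le]. *)
Lemma lyapunov_le_norm2 (R : realType) (d : nat) (disp disp' : measure_display)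
    (T : measurableType disp) (P : probability T R)
    (W : measurableType disp') (Q : probability W R)
    (S : nat -> W -> 'rV[int]_d) (V : 'rV[int]_d -> {RV P >-> R})
    (alpha : 'rV[R]_d -> R) (l : 'rV[R]_d) (lambda := fine 'E_P[V 0%R]) :
  (1 <= d)%N -> simple_random_walk Q S -> iid V ->
  (forall x w, 0 <= V x w) -> ('E_P[V 0%R] < +oo)%E ->
  is_quenched_lyapunov Q S V alpha ->
  alpha l <= Num.sqrt (2 * d%:R * (expR lambda - 1)) * norm2 l.
Proof.
move=> hd hS V_iid V_ge0 V_int halpha.
have [theta [theta_le <-]] :=
  supporting_functional l (is_norm_sublinear (lyapunov_norm halpha)).
have dR : 0 < (2 * d)%:R :> R by rewrite ltr0n muln_gt0.
have := @sqr_norm2_le _ _ theta ((2 * d)%:R * expR lambda)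
  (fun y => alpha (map_mx intr y)).
rewrite mulr_gt0 ?expR_gt0// => /(_ isT) norm_theta.
apply: (le_trans (dotv_le_norm2 _ _)).
rewrite ler_wpM2r ?sqrtr_ge0// -[leLHS]ger0_norm ?sqrtr_ge0// -sqrtr_sqr.
apply: ler_wsqrtr; rewrite mulrBr mulr1 -natrM.
apply: norm_theta => [y|N y]; first exact: theta_le.
exact: (card_words_to_le hd hS V_iid V_ge0 V_int N y halpha).
Qed.

Lemma expR_sub1_le (R : realType) (x : R) : expR x - 1 <= x * expR x.
Proof.
have := expR_ge1Dx (- x); rewrite -(ler_pM2l (expR_gt0 x)) expRN divff ?gt_eqF ?expR_gt0//.
lra.
Qed.

Theorem theorem2 (R : realType) (d : nat) (hd : (1 <= d)%N)
    (disp disp' : measure_display)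
    (Omega : measurableType disp) (P : probability Omega R)
    (W : measurableType disp') (Q : probability W R)
    (S : nat -> W -> 'rV[int]_d) (hS : simple_random_walk Q S)
    (V : R -> 'rV[int]_d -> {RV P >-> R})
    (hV_iid : forall gamma : R, 0 < gamma -> iid (V gamma))
    (hV_ge0 : forall gamma : R, 0 < gamma -> forall x w, 0 <= V gamma x w)
    (hV_pos : forall gamma : R, 0 < gamma ->
      (0 < P [set w | (0 < V gamma 0 w)%R])%E)
    (hV_int : forall gamma : R, 0 < gamma -> ('E_P[V gamma 0%R] < +oo)%E)
    (alpha : R -> 'rV[R]_d -> R)
    (halpha : forall gamma : R, 0 < gamma ->
      is_quenched_lyapunov Q S (V gamma) (alpha gamma))
    (l : 'rV[R]_d) :
  (limf_esup (fun gamma : R => (alpha gamma l / Num.sqrt gamma)%R%:E) 0^'+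
   <= limf_esup (fun gamma : R =>
        (Num.sqrt (2 * d%:R * fine 'E_P[V gamma 0%R] / gamma))%R%:E) 0^'+
      * (norm2 l)%:E)%E.
Proof.
set g := fun gamma : R => (Num.sqrt (2 * d%:R * _ / gamma))%:E.
have bound (gamma : R) : 0 < gamma -> alpha gamma l <=
    Num.sqrt (2 * d%:R * (expR (fine 'E_P[V gamma 0%R]) - 1)) * norm2 l.
  move=> g0; exact: (lyapunov_le_norm2 l hd hS (hV_iid _ g0) (hV_ge0 _ g0)
    (hV_int _ g0) (halpha _ g0)).
have L0 : (0 <= limf_esup g 0^'+)%E.
  apply: limf_esup_ge0; first exact: filter_not_empty.
  by move=> gamma; rewrite lee_fin sqrtr_ge0.
(* When norm2 l = 0, the nonasymptotic bound makes alpha gamma l nonpositive. *)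
have := sqrtr_ge0 (\sum_(i < d) l 0 i ^+ 2); rewrite -/(norm2 l).
rewrite le_eqVlt => /predU1P[n0|n0].
  rewrite -n0 mule0; apply: limf_esup_le; near=> gamma.
  have g0 : 0 < gamma by near: gamma; exact: nbhs_right_gt.
  rewrite /= lee_fin pmulr_lle0 ?invr_gt0 ?sqrtr_gt0//.
  by have := bound gamma g0; rewrite -n0 mulr0.
have near_g b : (limf_esup g 0^'+ < b)%E -> \forall gamma \near 0^'+, (g gamma <= b)%E.
  exact: limf_esup_lt.
case: (limf_esup g 0^'+) L0 near_g => [r||//]; last first.
  move=> _ _.
  by rewrite gt0_mulye ?lte_fin// leey.
rewrite lee_fin => r0 near_g.
apply/lee_addgt0Pr => e e0.
set n := norm2 l in n0 bound *.
(* The allowed excess e is shared: c exceeds the upper limit r of g by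
   e / (2 n), and the factor q > 1 leaves room for sqrt (e^lambda). *)
pose c := r + e / (2 * n).
have c0 : 0 < c by rewrite ltr_wpDl// divr_gt0// mulr_gt0.
have cn : c * n = r * n + e / 2 by rewrite /c; field; rewrite gt_eqF.
pose q := (r * n + e) / (c * n).
have q1 : 1 < q by rewrite /q ltr_pdivlMr ?mulr_gt0// mul1r cn; lra.
have dR : 0 < d%:R :> R by rewrite ltr0n.
(* g gamma <= c means 2 d lambda <= c^2 gamma, so that e^lambda <= q^2 as soon
   as gamma < gamma0. *)
pose gamma0 := 2 * d%:R * ln (q ^+ 2) / c ^+ 2.
have gamma0_gt0 : 0 < gamma0.
  by rewrite !mulr_gt0 ?invr_gt0 ?exprn_gt0// ln_gt0// exprn_egt1.
have g_le_c := near_g c%:E; rewrite lte_fin ltrDl divr_gt0 ?mulr_gt0// in g_le_c.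
rewrite -EFinM -EFinD; apply: limf_esup_le; near=> gamma.
have g0 : 0 < gamma by near: gamma; exact: nbhs_right_gt.
have gs : gamma < gamma0 by near: gamma; exact: nbhs_right_lt.
have : (g gamma <= c%:E)%E by near: gamma; exact: g_le_c.
rewrite /= !lee_fin; have := bound gamma g0.
set lambda := fine _ => alpha_le g_c.
have lam0 : 0 <= lambda.
  apply: fine_ge0; apply: expectation_ge0 => w; exact: hV_ge0.
have sg0 : 0 < Num.sqrt gamma by rewrite sqrtr_gt0.
have exp_le : expR lambda <= q ^+ 2.
  have q2 : 0 < q ^+ 2 by rewrite exprn_gt0// (lt_trans ltr01).
  rewrite -[leRHS]lnK ?posrE// ler_expR.
  have : 2 * d%:R * lambda / gamma <= c ^+ 2.
    rewrite -ler_sqrt ?exprn_ge0 ?exprn_gt0 ?(ltW c0)// sqrtr_sqr (ger0_norm (ltW c0)).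
    exact: g_c.
  rewrite ler_pdivrMr// => h.
  move: gs; rewrite /gamma0 ltr_pdivlMr ?exprn_gt0// => gs.
  have : 2 * d%:R * lambda <= 2 * d%:R * ln (q ^+ 2).
    by rewrite (le_trans h)// mulrC ltW.
  by rewrite ler_pM2l// mulr_gt0.
have key : Num.sqrt (2 * d%:R * (expR lambda - 1)) <=
    Num.sqrt (2 * d%:R * lambda / gamma) * Num.sqrt gamma * q.
  rewrite -sqrtrM; last by rewrite !mulr_ge0// invr_ge0 ltW.
  rewrite divfK ?gt_eqF// -[q in leRHS]gtr0_norm ?(lt_trans ltr01)//.
  rewrite -sqrtr_sqr -sqrtrM ?mulr_ge0//; apply: ler_wsqrtr.
  rewrite -[leRHS]mulrA ler_wpM2l ?mulr_ge0//.
  by rewrite (le_trans (expR_sub1_le _))// ler_wpM2l.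
rewrite ler_pdivrMr//; apply: (le_trans alpha_le).
apply: (@le_trans _ _ (c * Num.sqrt gamma * q * n)).
  rewrite ler_wpM2r ?(ltW n0)//; apply: (le_trans key).
  by rewrite ler_wpM2r ?(ltW (lt_trans ltr01 q1))// ler_wpM2r// ltW.
rewrite le_eqVlt; apply/orP; left; apply/eqP.
have -> : c * Num.sqrt gamma * q * n = (c * n) * q * Num.sqrt gamma by ring.
by rewrite /q [c * n * _]mulrC divfK ?gt_eqF ?mulr_gt0.
Unshelve. all: by end_near. Qed.
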